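(* Let $n_1,n_2,n_3\ge 2$ and let $G=P_{n_1}\Box P_{n_2}\Box P_{n_3}$. Then $\dim(G)=3$. Moreover, any set formed by three corners of a face of $G$ is a metric basis of $G$.
   Context: $P_{n_1}\Box P_{n_2}\Box P_{n_3}$ is the cartesian product of paths, with vertex set $\{(x_1,x_2,x_3): 0\le x_i\le n_i-1\}$, two vertices being adjacent iff they differ by exactly $1$ in exactly one coordinate; hence $d((x_1,x_2,x_3),(y_1,y_2,y_3))=\sum_i|x_i-y_i|$. A vertex $w$ resolves vertices $x,y$ if $d(w,x)\ne d(w,y)$. A set $S$ of vertices is a resolving set if every pair of distinct vertices is resolved by some vertex of $S$; $\dim(G)$ (the metric dimension) is the minimum cardinality of a resolving set, and a metric basis is a resolving set of that cardinality. Corners are the vertices of degree 3, i.e. those with $x_i\in\{0,n_i-1\}$ for all $i$. A face is the set of vertices with $x_{i_0}$ equal to a fixed value in $\{0,n_{i_0}-1\}$ for some $i_0\in\{1,2,3\}$. *)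

(* Defs.v *)
From mathcomp Require Export all_boot.

Set Implicit Arguments.
Unset Strict Implicit.
Unset Printing Implicit Defensive.

(* A finite graph is given by its adjacency relation e : rel T. *)
Section MetricDimension.
Variables (T : finType) (e : rel T).
Implicit Types (x y w : T) (S : {set T}).

Definition has_walk k x y : bool :=
  [exists p : k.-tuple T, path e x p && (last x p == y)].

(* The least length of a walk from x to y. Such a length is < #|T| as soon as
   y is reachable from x; the value is #|T| when it is not. *)
Definition dist x y : nat := find (fun k => has_walk k x y) (iota 0 #|T|).

Definition resolves w x y : bool := dist w x != dist w y.

Definition resolving S : bool :=
  [forall x, forall y, (x != y) ==> [exists w in S, resolves w x y]].

(* The default #|T| is harmless: the whole vertex set is resolving. *)
Definition metric_dim : nat := \big[minn/#|T|]_(S | resolving S) #|S|.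

Definition metric_basis S : bool := resolving S && (#|S| == metric_dim).

Definition degree x : nat := #|[set y | e x y]|.

End MetricDimension.

Definition path_graph n : rel 'I_n :=
  fun i j => (i.+1 == j :> nat) || (j.+1 == i :> nat).

Definition cart_prod (T1 T2 : finType) (e1 : rel T1) (e2 : rel T2) :
    rel (T1 * T2) :=
  fun x y => (e1 x.1 y.1 && (x.2 == y.2)) || ((x.1 == y.1) && e2 x.2 y.2).

Section Grid.
Variables n1 n2 n3 : nat.

Definition grid_vertex : finType := ('I_n1 * 'I_n2 * 'I_n3)%type.

Definition grid : rel grid_vertex :=
  cart_prod (cart_prod (@path_graph n1) (@path_graph n2)) (@path_graph n3).

Definition coord (x : grid_vertex) (i : 'I_3) : nat :=
  tnth [tuple val x.1.1; val x.1.2; val x.2] i.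

Definition side (i : 'I_3) : nat := tnth [tuple n1; n2; n3] i.

Definition corner (x : grid_vertex) : bool := degree grid x == 3.

Definition face (F : {set grid_vertex}) : Prop :=
  exists (i : 'I_3) (c : nat),
    (c = 0 \/ c = (side i).-1) /\ F = [set x | coord x i == c].

End Grid.

(* Main.v *)
Require Import Defs.
From mathcomp Require Import all_boot zify.

Set Implicit Arguments.
Unset Strict Implicit.
Unset Printing Implicit Defensive.

(** The distance is the l1 distance, so the graph is bipartite. If two vertices
    u, v resolved it, the neighbours of u, all at distance 1 from u, would be
    separated by their distance to v; but that distance takes only the two
    values d(v,u) - 1 and d(v,u) + 1, while u has at least 3 neighbours.
    Conversely, among three corners of a face, two differ exactly in the first
    free coordinate and two exactly in the second: the corresponding
    differences of distances determine these coordinates of a vertex, and any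
    one of the distances then determines the last coordinate. *)

(** * Integer-valued functions that are the distance of a bipartite graph *)

Section BipartiteMetric.
Variables (T : finType) (e : rel T) (D : T -> T -> nat).

(** [bm_step] makes every walk from x to y at least [D x y] long; as it excludes equality across an
    edge, the parity of [D z] is a 2-colouring. [bm_approach], followed backwards from y, yields a
    walk of length exactly [D x y]. *)
Record bipartite_metric : Prop := BipartiteMetric {
  bm_refl x : D x x = 0;
  bm_step z x y : e x y -> D z x = (D z y).+1 \/ D z y = (D z x).+1;
  bm_approach x y : x != y -> exists2 z, e z y & D x y = (D x z).+1
}.

Hypothesis bmD : bipartite_metric.

Lemma bm_path x p : path e x p -> D x (last x p) <= size p.
Proof.
elim/last_ind: p => [|p y IHp]; first by rewrite (bm_refl bmD).
rewrite rcons_path last_rcons size_rcons => /andP[/IHp le_p /(bm_step bmD x)].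
lia.
Qed.

Lemma bm_walk x y : has_walk e (D x y) x y.
Proof.
have [k] := ubnP (D x y); elim: k y => // k IHk y ltDk.
have [<-|/(bm_approach bmD)[z ezy Dxy]] := eqVneq x y.
  by rewrite (bm_refl bmD); apply/existsP; exists [tuple]; rewrite /= eqxx.
have /IHk/existsP[p /andP[ep /eqP lp]] : D x z < k by lia.
rewrite Dxy; apply/existsP; exists [tuple of rcons p y].
by rewrite /= rcons_path ep lp ezy last_rcons eqxx.
Qed.

(** The bound matters because [dist] tries only lengths below [#|T|]. *)
Lemma bm_dist x y : D x y < #|T| -> dist e x y = D x y.
Proof.
move=> ltD; rewrite /dist; set a := fun k => _.
have ha : has a (iota 0 #|T|).
  by apply/hasP; exists (D x y); rewrite ?mem_iota //; apply: bm_walk.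
apply/eqP; rewrite eqn_leq; apply/andP; split.
  rewrite leqNgt; apply/negP => /(before_find 0).
  by rewrite nth_iota // /a bm_walk.
have := nth_find 0 ha; rewrite has_find size_iota in ha.
rewrite nth_iota // add0n => /existsP[p /andP[ep /eqP <-]].
by rewrite -[X in _ <= X](size_tuple p); apply: bm_path.
Qed.

Lemma bm_resolving_ge3 (u0 : T) (S : {set T}) :
    (forall x y, D x y < #|T|) -> (forall x, 3 <= degree e x) ->
  resolving e S -> 3 <= #|S|.
Proof.
move=> ltD deg3 resS; rewrite ltnNge; apply/negP => leS2.
(* Here u = v is allowed; [u0] serves when S is empty. *)
have [u [v subS]] : exists u v, forall w, w \in S -> w = u \/ w = v.
  have [->|/set0Pn[u uS]] := eqVneq S set0.
    by exists u0, u0 => w; rewrite inE.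
  have : #|S :\ u| <= 1 by rewrite (cardsD1 u) uS in leS2.
  have [S0|/set0Pn[v vS]] := eqVneq (S :\ u) set0.
    move=> _; exists u, u => w wS; left; apply/eqP; apply: contraT => neq.
    by have := in_set0 w; rewrite -S0 !inE neq wS.
  move=> /card_le1_eqP/(_ v _ vS) eqv; exists u, v => w wS.
  have [->|neq] := eqVneq w u; [by left | right].
  by rewrite (eqv w) // !inE neq.
(* The boolean [f y] tells which of its two possible values [D v y] takes, so two of the three or
   more neighbours of u collide. *)
pose N := [set y | e u y]; pose f y := D v y == (D v u).+1.
have /dinjectivePn[y1 y1N [y2]] : ~~ dinjectiveb f (mem N).
  apply/negP => /dinjectiveP/leq_card_in.
  by rewrite card_bool leqNgt deg3.
rewrite !inE in y1N * => /andP[neq y2N] eqf.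
move/forallP/(_ y1)/forallP/(_ y2): resS; rewrite eq_sym neq /=.
case/exists_inP=> w /subS wuv; rewrite /resolves !bm_dist //.
have := bm_step bmD w y1N; have := bm_step bmD w y2N; move: eqf; rewrite /f.
have := bm_refl bmD u; case: wuv => ->; lia.
Qed.

End BipartiteMetric.

(** * Distances and degrees in cartesian products *)

Lemma bipartite_metric_cart_prod (T1 T2 : finType) (e1 : rel T1) (e2 : rel T2)
    D1 D2 :
    bipartite_metric e1 D1 -> bipartite_metric e2 D2 ->
  bipartite_metric (cart_prod e1 e2) (fun x y => D1 x.1 y.1 + D2 x.2 y.2).
Proof.
move=> bm1 bm2; split=> [x|z x y|[x1 x2] [y1 y2]].
- by rewrite (bm_refl bm1) (bm_refl bm2).
- case/orP=> /andP[].
    by move/(bm_step bm1 z.1) => ? /eqP->; lia.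
  by move=> /eqP-> /(bm_step bm2 z.2); lia.
have [<-|ne1 _] := eqVneq x1 y1; last first.
  have [z ez Dz] := bm_approach bm1 ne1.
  by exists (z, y2); rewrite /cart_prod /= ?ez ?eqxx // Dz.
rewrite xpair_eqE eqxx /= => ne2; have [z ez Dz] := bm_approach bm2 ne2.
by exists (x1, z); rewrite /cart_prod /= ?ez ?eqxx ?orbT // Dz addnS.
Qed.

(** A neighbour moves either the first or the second component; irreflexivity of [e1] keeps the two
    kinds disjoint. *)
Lemma degree_cart_prod (T1 T2 : finType) (e1 : rel T1) (e2 : rel T2) x :
    irreflexive e1 -> degree (cart_prod e1 e2) x = degree e1 x.1 + degree e2 x.2.
Proof.
case: x => x1 x2 irr1; rewrite /degree /=.
set A1 := [set y | e1 x1 y]; set A2 := [set y | e2 x2 y].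
have -> : [set y | cart_prod e1 e2 (x1, x2) y] =
    setX A1 [set x2] :|: setX [set x1] A2.
  apply/setP=> -[y1 y2]; rewrite !inE /cart_prod /=.
  by rewrite ![_ == x1]eq_sym ![_ == x2]eq_sym.
rewrite cardsU !cardsX !cards1 muln1 mul1n.
suff -> : setX A1 [set x2] :&: setX [set x1] A2 = set0 by rewrite cards0 subn0.
apply/setP=> -[y1 y2]; rewrite !inE /=.
by case: (y1 =P x1) => [->|]; rewrite ?irr1 ?andbF.
Qed.

(** * Distances and degrees in paths *)

Definition absdiff (m n : nat) : nat := maxn m n - minn m n.

Lemma bipartite_metric_path_graph n :
  bipartite_metric (@path_graph n) (fun i j => absdiff i j).
Proof.
rewrite /absdiff /path_graph; split=> [i|k i j|i j]; [lia | lia |].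
rewrite -val_eqE /= => neq; have ltjn := ltn_ord j; have ltin := ltn_ord i.
have lt1 : j.-1 < n by lia.
have [ltij|leji] := ltnP i j; first by exists (Ordinal lt1) => /=; lia.
have lt2 : j.+1 < n by lia.
by exists (Ordinal lt2) => /=; lia.
Qed.

Lemma path_graph_irr n : irreflexive (@path_graph n).
Proof. by move=> i; rewrite /path_graph; lia. Qed.

Lemma degree_path_graph_gt0 n (i : 'I_n) : 2 <= n -> 0 < degree (@path_graph n) i.
Proof.
move=> n2; have ltin := ltn_ord i; apply/card_gt0P.
have lt1 : i.-1 < n by lia.
case: (posnP i) => [i0|i0].
  have lt2 : i.+1 < n by lia.
  by exists (Ordinal lt2); rewrite inE /path_graph /= eqxx.
by exists (Ordinal lt1); rewrite inE /path_graph /=; lia.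
Qed.

Definition extreme n k := (k == 0) || (k == n.-1).

(** An interior vertex i has the two neighbours i - 1 and i + 1. *)
Lemma degree_path_graph1 n (i : 'I_n) :
  degree (@path_graph n) i <= 1 -> extreme n i.
Proof.
apply: contraTT; rewrite -ltnNge /extreme => int; have ltin := ltn_ord i.
have lt1 : i.-1 < n by lia.
have lt2 : i.+1 < n by lia.
apply/card_gt1P; exists (Ordinal lt1), (Ordinal lt2).
by split; rewrite ?inE /path_graph -?val_eqE /=; lia.
Qed.

(** * Recovering coordinates from distances to corners *)

Lemma absdiff_extreme_inj n a x y :
  extreme n a -> x < n -> y < n -> absdiff a x = absdiff a y -> x = y.
Proof. by rewrite /absdiff => /orP[]/eqP->; lia. Qed.

(** The distances to the two ends are x and n - 1 - x, so subtracting the equations cancels k and k'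
    and leaves 2x = 2y. *)
Lemma absdiff_extremes_inj n a a' x y k k' :
    extreme n a -> extreme n a' -> a <> a' -> x < n -> y < n ->
    absdiff a x + k = absdiff a y + k' -> absdiff a' x + k = absdiff a' y + k' ->
  x = y.
Proof. by rewrite /absdiff => /orP[]/eqP-> /orP[]/eqP->; lia. Qed.

(* [p b] and [q b] stand for the part of the distances from the corner to the
   two vertices that does not involve the coordinate [a] of the corner. *)
Lemma three_corners_inj n m a1 a2 a3 b1 b2 b3 x y (p q : nat -> nat) :
    extreme n a1 -> extreme n a2 -> extreme n a3 ->
    extreme m b1 -> extreme m b2 -> extreme m b3 ->
    ~~ ((a1 == a2) && (b1 == b2)) -> ~~ ((a2 == a3) && (b2 == b3)) ->
    ~~ ((a3 == a1) && (b3 == b1)) -> x < n -> y < n ->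
    absdiff a1 x + p b1 = absdiff a1 y + q b1 ->
    absdiff a2 x + p b2 = absdiff a2 y + q b2 ->
    absdiff a3 x + p b3 = absdiff a3 y + q b3 ->
  x = y.
Proof.
move=> ea1 ea2 ea3 eb1 eb2 eb3 ne12 ne23 ne31 xn yn d1 d2 d3.
(* Pigeonhole: b takes only two values. Two corners with the same b have opposite ends as a, and the
   same [p] and [q] terms. *)
have : [\/ b1 = b2, b2 = b3 | b3 = b1].
  case/orP: eb1 eb2 eb3 => /eqP-> /orP[]/eqP-> /orP[]/eqP->;
  by [constructor 1 | constructor 2 | constructor 3].
case=> eqb; rewrite eqb eqxx andbT in ne12 ne23 ne31 d1 d2 d3.
- exact: absdiff_extremes_inj ea1 ea2 (elimN eqP ne12) xn yn d1 d2.
- exact: absdiff_extremes_inj ea2 ea3 (elimN eqP ne23) xn yn d2 d3.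
exact: absdiff_extremes_inj ea3 ea1 (elimN eqP ne31) xn yn d3 d1.
Qed.

Lemma face_corners_inj n m l a1 a2 a3 b1 b2 b3 c x1 x2 x3 y1 y2 y3 :
    extreme n a1 -> extreme n a2 -> extreme n a3 ->
    extreme m b1 -> extreme m b2 -> extreme m b3 -> extreme l c ->
    ~~ ((a1 == a2) && (b1 == b2)) -> ~~ ((a2 == a3) && (b2 == b3)) ->
    ~~ ((a3 == a1) && (b3 == b1)) ->
    x1 < n -> x2 < m -> x3 < l -> y1 < n -> y2 < m -> y3 < l ->
    absdiff a1 x1 + absdiff b1 x2 + absdiff c x3 =
      absdiff a1 y1 + absdiff b1 y2 + absdiff c y3 ->
    absdiff a2 x1 + absdiff b2 x2 + absdiff c x3 =
      absdiff a2 y1 + absdiff b2 y2 + absdiff c y3 ->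
    absdiff a3 x1 + absdiff b3 x2 + absdiff c x3 =
      absdiff a3 y1 + absdiff b3 y2 + absdiff c y3 ->
  [/\ x1 = y1, x2 = y2 & x3 = y3].
Proof.
move=> ea1 ea2 ea3 eb1 eb2 eb3 ec ne12 ne23 ne31 x1n x2m x3l y1n y2m y3l d1 d2 d3.
have eq1 : x1 = y1.
  by apply: (three_corners_inj (p := fun b => absdiff b x2 + absdiff c x3)
    (q := fun b => absdiff b y2 + absdiff c y3)
    ea1 ea2 ea3 eb1 eb2 eb3 ne12 ne23 ne31) => //=; rewrite !addnA.
have eq2 : x2 = y2.
  (* Now a and b exchange roles. Since x1 = y1, the terms in a cancel, which leaves constant [p] and
     [q]. *)
  rewrite andbC in ne12; rewrite andbC in ne23; rewrite andbC in ne31.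
  rewrite eq1 in d1 d2 d3.
  by apply: (three_corners_inj (p := fun=> absdiff c x3)
    (q := fun=> absdiff c y3) eb1 eb2 eb3 ea1 ea2 ea3 ne12 ne23 ne31) => //; lia.
split=> //; rewrite eq1 eq2 in d1.
by apply: (absdiff_extreme_inj ec x3l y3l); apply: addnI d1.
Qed.

(** * The three-dimensional grid *)

Section Grid.
Variables n1 n2 n3 : nat.
Hypotheses (n1_ge2 : 2 <= n1) (n2_ge2 : 2 <= n2) (n3_ge2 : 2 <= n3).
Implicit Types x y w : grid_vertex n1 n2 n3.
Local Notation G := (@grid n1 n2 n3).

Definition l1 x y :=
  absdiff x.1.1 y.1.1 + absdiff x.1.2 y.1.2 + absdiff x.2 y.2.

Lemma bipartite_metric_grid : bipartite_metric G l1.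
Proof.
exact: (bipartite_metric_cart_prod
  (bipartite_metric_cart_prod (bipartite_metric_path_graph n1)
    (bipartite_metric_path_graph n2)) (bipartite_metric_path_graph n3)).
Qed.

(** The distance is below n1 + n2 + n3, and a sum of two integers that are at least 2 is at most
    their product. *)
Lemma l1_lt_card x y : l1 x y < #|grid_vertex n1 n2 n3|.
Proof.
rewrite !card_prod !card_ord /l1 /absdiff.
case: x y => [[x1 x2] x3] [[y1 y2] y3] /=.
have := (ltn_ord x1, ltn_ord x2, ltn_ord x3, ltn_ord y1, ltn_ord y2, ltn_ord y3).
case=> [[[[[]]]]] *.
have le12 : n1 + n2 <= n1 * n2 by nia.
have : n1 * n2 + n3 <= n1 * n2 * n3 by nia.
lia.
Qed.

Lemma dist_grid x y : dist G x y = l1 x y.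
Proof. exact: (bm_dist bipartite_metric_grid (l1_lt_card x y)). Qed.

Lemma degree_grid x :
  degree G x = degree (@path_graph n1) x.1.1 + degree (@path_graph n2) x.1.2
               + degree (@path_graph n3) x.2.
Proof.
rewrite /grid !degree_cart_prod //; first exact: path_graph_irr.
by move=> y; rewrite /cart_prod !path_graph_irr andbF.
Qed.

Lemma degree_grid_ge3 x : 3 <= degree G x.
Proof.
have := degree_path_graph_gt0 x.1.1 n1_ge2.
have := degree_path_graph_gt0 x.1.2 n2_ge2.
have := degree_path_graph_gt0 x.2 n3_ge2.
by rewrite degree_grid; lia.
Qed.

(** Three positive path degrees with sum 3 are all 1. *)
Lemma corner_extreme x :
  corner x -> [/\ extreme n1 x.1.1, extreme n2 x.1.2 & extreme n3 x.2].
Proof.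
have := degree_path_graph_gt0 x.1.1 n1_ge2.
have := degree_path_graph_gt0 x.1.2 n2_ge2.
have := degree_path_graph_gt0 x.2 n3_ge2.
rewrite /corner degree_grid => ? ? ? ?.
by split; apply: degree_path_graph1; lia.
Qed.

Lemma resolving_grid_ge3 (S : {set grid_vertex n1 n2 n3}) :
  resolving G S -> 3 <= #|S|.
Proof.
apply: (bm_resolving_ge3 bipartite_metric_grid _ l1_lt_card degree_grid_ge3).
exact: (Ordinal (ltnW n1_ge2), Ordinal (ltnW n2_ge2), Ordinal (ltnW n3_ge2)).
Qed.

(** Phrased with [extreme], this serves both for the explicit triple that bounds the dimension and
    for arbitrary corners of a face. *)
Lemma resolving_face_corners (S : {set grid_vertex n1 n2 n3}) i c :
    {in S, forall x, coord x i = c} ->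
    {in S, forall x, [/\ extreme n1 x.1.1, extreme n2 x.1.2 & extreme n3 x.2]} ->
  2 < #|S| -> resolving G S.
Proof.
move=> Sc Sext /card_gt2P[u [v [w [[uS vS wS] [uv vw wu]]]]].
apply/forallP=> x; apply/forallP=> y; apply/implyP; apply: contraNT.
rewrite negb_exists_in => /forall_inP eqd.
have {eqd} eqd t : t \in S -> l1 t x = l1 t y.
  by move=> /eqd; rewrite /resolves negbK !dist_grid => /eqP.
move: uv vw wu (Sc u uS) (Sc v vS) (Sc w wS) (Sext u uS) (Sext v vS) (Sext w wS)
  (eqd u uS) (eqd v vS) (eqd w wS).
rewrite /l1 /coord {Sc Sext eqd uS vS wS}.
case: x y u v w => [[x1 x2] x3] [[y1 y2] y3] [[u1 u2] u3] [[v1 v2] v3] [[w1 w2] w3].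
rewrite !xpair_eqE -!val_eqE /= => uv vw wu uc vc wc
  [eu1 eu2 eu3] [ev1 ev2 ev3] [ew1 ew2 ew3] du dv dw.
(* One case per fixed coordinate; its term is brought to the last place, as [face_corners_inj]
   expects. *)
case: i uc vc wc => [[|[|[|//]]] ilt]; rewrite !(tnth_nth 0) /= => uc vc wc.
- rewrite uc vc wc eqxx /= in uv vw wu du dv dw eu1.
  rewrite -!addnA ![absdiff c _ + _]addnC in du dv dw.
  by have [//|//|//|//|//|//|-> -> ->] :=
    face_corners_inj eu2 ev2 ew2 eu3 ev3 ew3 eu1 uv vw wu _ _ _ _ _ _ du dv dw;
    rewrite ?eqxx.
- rewrite uc vc wc eqxx !andbT in uv vw wu du dv dw eu2.
  rewrite ![_ + absdiff c _ + _]addnAC in du dv dw.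
  by have [//|//|//|//|//|//|-> -> ->] :=
    face_corners_inj eu1 ev1 ew1 eu3 ev3 ew3 eu2 uv vw wu _ _ _ _ _ _ du dv dw;
    rewrite ?eqxx.
rewrite uc vc wc eqxx !andbT in uv vw wu du dv dw eu3.
by have [//|//|//|//|//|//|-> -> ->] :=
  face_corners_inj eu1 ev1 ew1 eu2 ev2 ew2 eu3 uv vw wu _ _ _ _ _ _ du dv dw;
  rewrite ?eqxx.
Qed.

End Grid.

(** * The metric dimension and the metric bases *)

Lemma bigmin_le (I : finType) (P : pred I) (F : I -> nat) d i :
  P i -> \big[minn/d]_(j | P j) F j <= F i.
Proof.
move=> Pi; rewrite -big_filter.
have : i \in [seq j <- index_enum I | P j] by rewrite mem_filter Pi mem_index_enum.
elim: [seq _ <- _ | _] => //= j s IHs; rewrite big_cons inE geq_min.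
by case/predU1P=> [->|/IHs->]; rewrite ?leqnn ?orbT.
Qed.

Theorem theorem2 (n1 n2 n3 : nat) (hn1 : 2 <= n1) (hn2 : 2 <= n2)
    (hn3 : 2 <= n3) :
  metric_dim (@grid n1 n2 n3) = 3 /\
  (forall F S : {set grid_vertex n1 n2 n3},
     face F -> S \subset F -> {in S, forall x, corner x} -> #|S| = 3 ->
     metric_basis (@grid n1 n2 n3) S).
Proof.
have dim3 : metric_dim (@grid n1 n2 n3) = 3.
  apply/eqP; rewrite eqn_leq; apply/andP; split; last first.
    rewrite /metric_dim; apply: (big_ind (fun m => 3 <= m)).
    (* The default value of the minimum must be at least 3 too: the set of all vertices is
       resolving, as x resolves itself from any other vertex. *)
    - apply: leq_trans (max_card (mem setT)).
      apply: resolving_grid_ge3 => //; apply/forallP=> x; apply/forallP=> y.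
      apply/implyP=> neq; apply/exists_inP; exists x; rewrite ?inE //.
      rewrite /resolves !dist_grid //; move: neq; rewrite /l1 /absdiff.
      case: x y => [[x1 x2] x3] [[y1 y2] y3].
      by rewrite !xpair_eqE -!val_eqE /=; lia.
    - by move=> a b a3 b3; rewrite leq_min a3.
    by move=> S; apply: resolving_grid_ge3.
  have p1 : n1.-1 < n1 by lia.
  have p2 : n2.-1 < n2 by lia.
  pose z1 := Ordinal (ltnW hn1); pose z2 := Ordinal (ltnW hn2).
  pose z3 := Ordinal (ltnW hn3).
  (* Three corners of the face where the third coordinate is 0: the origin and the far ends of its
     two edges in that face. *)
  pose S : {set grid_vertex n1 n2 n3} :=
    [set (z1, z2, z3); (Ordinal p1, z2, z3); (z1, Ordinal p2, z3)].
  have cS : #|S| = 3.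
    rewrite /S setUC cardsU1 cards2 !inE !xpair_eqE -!val_eqE /=; lia.
  rewrite -cS; apply: bigmin_le.
  apply: (@resolving_face_corners _ _ _ hn1 hn2 hn3 S ord_max 0).
  - by move=> x; rewrite !inE => /orP[/orP[]|] /eqP->.
  - move=> x; rewrite !inE /extreme => /orP[/orP[]|] /eqP-> /=;
    by rewrite ?eqxx ?orbT.
  by rewrite cS.
split=> // F S [i [c [_ ->]]] /subsetP subF cornS cS.
rewrite /metric_basis dim3 cS eqxx andbT.
apply: (@resolving_face_corners _ _ _ hn1 hn2 hn3 S i c); last by rewrite cS.
  by move=> x /subF; rewrite inE => /eqP.
by move=> x /cornS; apply: corner_extreme.
Qed.
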